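(* Let $(X,p,E)$ be a $p$-complete lattice-normed vector lattice such that the vector lattice $E$ is atomic and $p$ is additive on $X_+$, i.e. $p(x+y)=p(x)+p(y)$ for all $x,y\in X_+$. Then $X$ is a $p$-KB-space.
   Context: All vector lattices are real and Archimedean. A net $(x_\alpha)$ in a vector lattice is order convergent to $x$ ($x_\alpha\xrightarrow{o}x$) if there is a net $(y_\beta)$ (possibly with a different index set) with $y_\beta\downarrow 0$ such that for each $\beta$ there is $\alpha_\beta$ with $|x_\alpha-x|\le y_\beta$ for all $\alpha\ge\alpha_\beta$. An atom of $E$ is an element $a>0$ such that $0\le x\le a$ implies $x=\lambda a$ for some $\lambda\in\mathbb{R}$; $E$ is atomic if for each $0<x\in E$ there is an atom $a$ with $0<a\le x$. A lattice-normed vector lattice (LNVL) is a triple $(X,p,E)$, where $X$ and $E$ are vector lattices and $p:X\to E_+$ satisfies: $p(x)=0\Leftrightarrow x=0$; $p(\lambda x)=|\lambda|p(x)$; $p(x+y)\le p(x)+p(y)$; and $|x|\le|y|\Rightarrow p(x)\le p(y)$. A net $x_\alpha$ $p$-converges to $x$ if $p(x_\alpha-x)\xrightarrow{o}0$ in $E$. A net $(x_\alpha)_{\alpha\in A}$ is $p$-Cauchy if $(x_\alpha-x_{\alpha'})_{(\alpha,\alpha')\in A\times A}$ $p$-converges to $0$; $X$ is $p$-complete if every $p$-Cauchy net is $p$-convergent. A subset $A\subseteq X$ is $p$-bounded if there is $e\in E$ with $p(a)\le e$ for all $a\in A$. An LNVL is a $p$-KB-space if every $p$-bounded increasing net in $X_+$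 is $p$-convergent. *)

(* Defs.v *)
From HB Require Import structures.
From mathcomp Require Import all_boot all_order all_algebra.
From mathcomp Require Import boolp classical_sets reals.

Set Implicit Arguments.
Unset Strict Implicit.
Unset Printing Implicit Defensive.
Import Order.TTheory GRing.Theory Num.Theory.
Local Open Scope classical_set_scope.
Local Open Scope ring_scope.

(* The lattice operations are fields of this mixin and the library's lattice
   structure is derived from them below: Hierarchy Builder has no join of
   Order.Lattice and GRing.Zmodule below Num.RealDomain, hence refuses a
   structure that inherits directly from both. *)
HB.mixin Record isVectorLattice (R : realType) E
    of GRing.Lmodule R E & Num.POrderedZmodule E := {
  vlat_leD2r : forall z x y : E, x <= y -> x + z <= y + z;
  vlat_scale_ge0 : forall (a : R) (x : E), 0 <= a -> 0 <= x -> 0 <= a *: x;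
  vlat_meet : E -> E -> E;
  vlat_join : E -> E -> E;
  vlat_lexI : forall x y z : E, (x <= vlat_meet y z) = (x <= y) && (x <= z);
  vlat_leUx : forall x y z : E, (vlat_join x y <= z) = (x <= z) && (y <= z)
}.

#[short(type="vectorLatticeType")]
HB.structure Definition VectorLattice (R : realType) :=
  { E of GRing.Lmodule R E & Num.POrderedZmodule E & isVectorLattice R E }.

#[non_forgetful_inheritance]
HB.instance Definition _ (R : realType) (E : vectorLatticeType R) :=
  Order.POrder_isMeetSemilattice.Build ring_display (VectorLattice.sort E)
    (@vlat_lexI R E).

#[non_forgetful_inheritance]
HB.instance Definition _ (R : realType) (E : vectorLatticeType R) :=
  Order.POrder_isJoinSemilattice.Build ring_display (VectorLattice.sort E)
    (@vlat_leUx R E).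

Section VectorLatticeDefs.
Variables (R : realType) (E : vectorLatticeType R).

Definition archimedean :=
  forall x y : E, 0 <= x -> (forall n : nat, x *+ n <= y) -> x = 0.

Definition vabs (x : E) : E := Order.join x (- x).

Definition atom (a : E) :=
  0 < a /\ forall x : E, 0 <= x <= a -> exists c : R, x = c *: a.

Definition atomic := forall x : E, 0 < x -> exists2 a : E, atom a & a <= x.

End VectorLatticeDefs.

Arguments archimedean {R} E.
Arguments atomic {R} E.

(* Index sets of nets; the order need not be antisymmetric. *)
Record directedSet := DirectedSet {
  dset :> Type;
  dle : dset -> dset -> Prop;
  dle_refl : forall i, dle i i;
  dle_trans : forall i j k, dle i j -> dle j k -> dle i k;
  dset_inhabited : inhabited dset;
  dset_directed : forall i j, exists k, dle i k /\ dle j k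
}.

Section ProductDirectedSet.
Variables A B : directedSet.

Definition prod_dle (i j : A * B) := dle i.1 j.1 /\ dle i.2 j.2.

Lemma prod_dle_refl i : prod_dle i i.
Proof. by split; apply: dle_refl. Qed.

Lemma prod_dle_trans i j k : prod_dle i j -> prod_dle j k -> prod_dle i k.
Proof.
by move=> [ij1 ij2] [jk1 jk2]; split; [apply: dle_trans jk1|apply: dle_trans jk2].
Qed.

Lemma prod_dset_inhabited : inhabited (A * B).
Proof. by case: (dset_inhabited A) => a; case: (dset_inhabited B) => b. Qed.

Lemma prod_dset_directed i j : exists k, prod_dle i k /\ prod_dle j k.
Proof.
have [k1 [ik1 jk1]] := dset_directed i.1 j.1.
have [k2 [ik2 jk2]] := dset_directed i.2 j.2.
by exists (k1, k2).
Qed.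

Definition prod_directedSet := DirectedSet prod_dle_refl prod_dle_trans
  prod_dset_inhabited prod_dset_directed.

End ProductDirectedSet.

Section Nets.
Variables (R : realType) (E : vectorLatticeType R).

Definition net_increasing (A : directedSet) (x : A -> E) :=
  forall i j, dle i j -> x i <= x j.

Definition net_decreasing (A : directedSet) (x : A -> E) :=
  forall i j, dle i j -> x j <= x i.

Definition net_down_to0 (B : directedSet) (y : B -> E) :=
  net_decreasing y /\ infimums (range y) 0.

Definition order_cvg (A : directedSet) (x : A -> E) (l : E) :=
  exists (B : directedSet) (y : B -> E), net_down_to0 y /\
    forall b : B, exists a0 : A, forall a : A, dle a0 a ->
      vabs (x a - l) <= y b.

End Nets.

Record latticeNorm (R : realType) (X E : vectorLatticeType R) := LatticeNorm {
  lnorm :> X -> E;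
  lnorm_ge0 : forall x, 0 <= lnorm x;
  lnorm_eq0 : forall x, lnorm x = 0 <-> x = 0;
  lnormZ : forall (c : R) x, lnorm (c *: x) = `|c| *: lnorm x;
  lnormD : forall x y, lnorm (x + y) <= lnorm x + lnorm y;
  lnorm_mono : forall x y, vabs x <= vabs y -> lnorm x <= lnorm y
}.

Section LatticeNormed.
Variables (R : realType) (X E : vectorLatticeType R) (p : latticeNorm X E).

Definition p_cvg (A : directedSet) (x : A -> X) (l : X) :=
  order_cvg (fun a => p (x a - l)) 0.

Definition p_cauchy (A : directedSet) (x : A -> X) :=
  @p_cvg (prod_directedSet A A) (fun ij => x ij.1 - x ij.2) 0.

Definition p_complete :=
  forall (A : directedSet) (x : A -> X), p_cauchy x -> exists l, p_cvg x l.

Definition p_bounded (S : set X) := exists e : E, forall a, S a -> p a <= e.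

Definition p_KB_space :=
  forall (A : directedSet) (x : A -> X),
    (forall a, 0 <= x a) -> net_increasing x -> p_bounded (range x) ->
    exists l, p_cvg x l.

End LatticeNormed.

(* Main.v *)
(**
  For an increasing net x in X_+, additivity of p makes u := p o x increasing,
  with p (x c - x a) = u c - u a for a <= c.  If z is an upper bound of u, then
  |x a - x b| <= x c - x a0 for a, b >= a0 and c >= a, b, so that
  p (x a - x b) <= z - u a0.  In an Archimedean vector lattice the differences
  z - u a0, indexed by the pairs (z, a0), decrease to 0: a lower bound w >= 0 of
  them makes z - w an upper bound of u again, hence also z - n w for every n.
  So x is p-Cauchy.
*)

Require Import Defs.
From mathcomp Require Import all_boot all_order all_algebra.
From mathcomp Require Import classical_sets reals.

Set Implicit Arguments.
Unset Strict Implicit.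
Unset Printing Implicit Defensive.
Import Order.TTheory GRing.Theory Num.Theory.
Local Open Scope classical_set_scope.
Local Open Scope ring_scope.

Section VectorLatticeTheory.
Variables (R : realType) (E : vectorLatticeType R).
Implicit Types x y z : E.

Lemma vlat_leBDr x y z : (x - y <= z) = (x <= z + y).
Proof.
apply/idP/idP => h.
- by rewrite -(subrK y x); apply: vlat_leD2r.
- by rewrite -(addrK y z); apply: vlat_leD2r.
Qed.

Lemma vlat_leBrDr x y z : (x <= y - z) = (x + z <= y).
Proof. by rewrite -vlat_leBDr opprK. Qed.

Lemma vlat_leBrC x y z : (x <= y - z) = (z <= y - x).
Proof. by rewrite !vlat_leBrDr addrC. Qed.

Lemma vlat_leB x1 y1 x2 y2 : x1 <= x2 -> y2 <= y1 -> x1 - y1 <= x2 - y2.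
Proof.
move=> lex ley; rewrite vlat_leBDr; apply: le_trans lex _.
rewrite -addrA [- y2 + y1]addrC addrA -[x in x <= _](addrK y2).
by apply: vlat_leD2r; rewrite ![x2 + _]addrC; apply: vlat_leD2r.
Qed.

Lemma vlat_subr_ge0 x y : (0 <= y - x) = (x <= y).
Proof. by rewrite vlat_leBrC subr0. Qed.

Lemma vabs_ge0_id x : 0 <= x -> vabs x = x.
Proof.
move=> x_ge0; apply: join_l; rewrite -vlat_subr_ge0 opprK.
by apply: (le_trans x_ge0); rewrite -{1}[x]add0r; apply: vlat_leD2r.
Qed.

End VectorLatticeTheory.

Section UpperBounds.
Variables (R : realType) (E : vectorLatticeType R) (A : directedSet).
Variables (u : A -> E) (e : E) (u_le_e : forall a, u a <= e).

Definition upper_bound := {z : E | forall a, u a <= z}.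

(** The order is reversed so that going up the index set tightens the bound; meets of upper bounds
    make it directed. *)
Definition upper_bound_dle (z1 z2 : upper_bound) : Prop := sval z2 <= sval z1.

Lemma upper_bound_dle_refl z : upper_bound_dle z z.
Proof. exact: lexx. Qed.

Lemma upper_bound_dle_trans z1 z2 z3 :
  upper_bound_dle z1 z2 -> upper_bound_dle z2 z3 -> upper_bound_dle z1 z3.
Proof. by move=> h12 h23; apply: le_trans h23 h12. Qed.

Lemma upper_bound_inhabited : inhabited upper_bound.
Proof. by constructor; exists e. Qed.

Lemma upper_bound_directed z1 z2 :
  exists z3, upper_bound_dle z1 z3 /\ upper_bound_dle z2 z3.
Proof.
have uz a : u a <= Order.meet (sval z1) (sval z2).
  by rewrite lexI (svalP z1) (svalP z2).
by exists (exist _ _ uz); split; [apply: leIl | apply: leIr].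
Qed.

Definition upper_bound_dset := DirectedSet upper_bound_dle_refl
  upper_bound_dle_trans upper_bound_inhabited upper_bound_directed.

Definition upper_bound_gap (i : prod_directedSet upper_bound_dset A) : E :=
  sval i.1 - u i.2.

Lemma upper_bound_gap_down_to0 :
  archimedean E -> net_increasing u -> net_down_to0 upper_bound_gap.
Proof.
move=> archiE u_incr; split.
  by move=> i j [le1 le2]; apply: vlat_leB => //; apply: u_incr.
split.
  by move=> _ [[[z uz] a] _ <-]; rewrite /upper_bound_gap /= vlat_subr_ge0.
(* An arbitrary lower bound [w] need not be positive, while [archiE] asks for a positive element.
   Its positive part [v] is still below every gap, since the gaps are positive. *)
move=> w w_lb; pose v := Order.join w 0.
have v_ge0 : 0 <= v by apply: leUr.
have v_le z a : (forall b, u b <= z) -> v <= z - u a.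
  move=> uz; rewrite leUx vlat_subr_ge0 uz andbT.
  by apply: w_lb; exists (exist _ z uz, a).
(* Once [e - v *+ n] bounds all of [u], [v_le] applies to it and allows one more [v] to be
   subtracted; hence the induction hypothesis must hold for every [a]. *)
have iter_ub n a : u a <= e - v *+ n.
  elim: n a => [|n IHn] a; first by rewrite mulr0n subr0.
  by rewrite mulrSr opprD addrA vlat_leBrC; apply: v_le.
have [a] := dset_inhabited A.
(* [w <= v], so it suffices that [v] vanishes: by [iter_ub], all its multiples stay below the fixed
   element [e - u a]. *)
suff <- : v = 0 by apply: leUl.
by apply: (archiE v (e - u a)) => // n; rewrite vlat_leBrC.
Qed.

End UpperBounds.

Section AdditiveLatticeNorm.
Variables (R : realType) (X E : vectorLatticeType R) (p : latticeNorm X E).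
Hypothesis additive_p :
  forall x y : X, 0 <= x -> 0 <= y -> p (x + y) = p x + p y.

(** Additivity applies to the decomposition of [y] into the positive elements [y - x] and [x]. *)
Lemma additive_lnormB x y : 0 <= x -> x <= y -> p (y - x) = p y - p x.
Proof.
move=> x_ge0 xy; rewrite -[y in p y - _](subrK x) (@additive_p (y - x) x) //.
  by rewrite addrK.
by rewrite vlat_subr_ge0.
Qed.

Lemma p_cauchy_increasing (A : directedSet) (x : A -> X) :
  archimedean E -> (forall a, 0 <= x a) -> net_increasing x ->
  p_bounded p (range x) -> p_cauchy p x.
Proof.
move=> archiE x_ge0 x_incr [e e_ub].
have px_le_e a : p (x a) <= e by apply: e_ub; exists a.
exists _, (@upper_bound_gap _ _ _ (p \o x) _ px_le_e); split.
  apply: upper_bound_gap_down_to0 => // a b ab /=.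
  (* [p \o x] increases because its increments are themselves values of [p]. *)
  rewrite -vlat_subr_ge0 -additive_lnormB ?lnorm_ge0 //; exact: x_incr.
move=> [[z uz] a0]; exists (a0, a0) => -[a b] [/= a0a a0b].
rewrite !subr0 vabs_ge0_id ?lnorm_ge0 // /upper_bound_gap /=.
have [c [ac bc]] := dset_directed a b.
have a0c := dle_trans a0a ac.
apply: (@le_trans _ _ (p (x c - x a0))).
  (* Both [x a - x b] and its opposite lie below [x c - x a0], as [x a] and [x b] lie between [x a0]
     and [x c]. *)
  apply: lnorm_mono; apply: le_trans (leUl _ _).
  by rewrite leUx opprB !vlat_leB // x_incr.
by rewrite additive_lnormB ?vlat_leB ?x_incr //; apply: uz.
Qed.

End AdditiveLatticeNorm.

Theorem proposition2p15 (R : realType) (X E : vectorLatticeType R)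
    (p : latticeNorm X E)
    (archiX : archimedean X) (archiE : archimedean E)
    (complete_p : p_complete p)
    (atomicE : atomic E)
    (additive_p : forall x y : X, 0 <= x -> 0 <= y -> p (x + y) = p x + p y) :
  p_KB_space p.
Proof.
move=> A x x_ge0 x_incr x_bounded; apply: complete_p.
exact: p_cauchy_increasing.
Qed.
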